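(* Let $f$, $G$, $\mathcal{D}$, $L$, $\sigma^2$, $\varepsilon$, $\Delta=f(x^0)-f^*$ be as in the hypotheses: $f:\mathbb{R}^d\to\mathbb{R}$ differentiable, $L$-smooth, bounded below by $f^*$, and $\mathbb{E}_{\xi\sim\mathcal{D}}[G(x;\xi)]=\nabla f(x)$, $\mathbb{E}_{\xi\sim\mathcal{D}}\|G(x;\xi)-\nabla f(x)\|^2\le\sigma^2$ for all $x$. Run Rennala SGD in the fixed computation model with $n$ workers and times $0<\tau_1\le\dots\le\tau_n$, batch size $S=\max\{\lceil\sigma^2/\varepsilon\rceil,1\}$ and stepsize $\gamma=\min\{1/L,\varepsilon S/(2L\sigma^2)\}$ ($\gamma=1/L$ if $\sigma^2=0$), and assume $K:=24L\Delta/\varepsilon$ is an integer. Then the server has computed $x^0,\dots,x^K$ by time $$96\cdot\min_{m\in[n]}\left[\Big(\frac1m\sum_{i=1}^m\frac1{\tau_i}\Big)^{-1}\Big(\frac{L\Delta}{\varepsilon}+\frac{\sigma^2L\Delta}{m\varepsilon^2}\Big)\right],$$ and $\frac1K\sum_{k=0}^{K-1}\mathbb{E}\|\nabla f(x^k)\|^2\le\varepsilon$.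
   Context: Rennala SGD in the fixed computation model: there are a server and $n$ workers; worker $i$ needs exactly $\tau_i$ seconds to compute one stochastic gradient $G(x;\xi)$ with a fresh independent $\xi\sim\mathcal{D}$; communication is instantaneous. At time $0$ every worker receives $(x^0,0)$ and starts computing. Each worker repeatedly: when it has received a pair $(x^k,k)$ it computes $G(x^k;\xi)$ (taking $\tau_i$ seconds), sends $(G(x^k;\xi),k)$ to the server, immediately receives back a pair, and starts computing at the received point. The server runs iterations $k=0,1,\dots,K-1$: it sets $g^k=0$ and an acceptance counter to $0$; whenever a pair $(g,k')$ arrives from a worker, if $k'=k$ it adds $g/S$ to $g^k$ and increments the counter, otherwise it discards $g$; in either case it then sends the current pair $(x^k,k)$ back to that worker; as soon as $S$ gradients have been accepted it sets $x^{k+1}=x^k-\gamma g^k$ and starts iteration $k+1$. *)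

(* Defs.v *)
From HB Require Import structures.
From mathcomp Require Import all_boot all_order all_algebra.
From mathcomp Require Import all_classical all_reals all_analysis.
Set Implicit Arguments. Unset Strict Implicit. Unset Printing Implicit Defensive.
Import Order.TTheory GRing.Theory Num.Theory.
Import numFieldNormedType.Exports.
Local Open Scope classical_set_scope.
Local Open Scope ring_scope.

Definition sqnorm {R : realType} {d : nat} (v : 'rV[R]_d) : R :=
  \sum_(i < d) (v 0 i) ^+ 2.

Definition enorm {R : realType} {d : nat} (v : 'rV[R]_d) : R :=
  Num.sqrt (sqnorm v).

Definition gradient {R : realType} {d : nat} (f : 'rV[R]_d -> R)
  (x : 'rV[R]_d) : 'rV[R]_d :=
  \row_(i < d) ('d f x (delta_mx 0 i : 'rV[R]_d)).

Definition L_smooth {R : realType} {d : nat} (L : R) (f : 'rV[R]_d -> R) :=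
  forall x y, enorm (gradient f x - gradient f y) <= L * enorm (x - y).

(* Joint measurability of G : R^d x Xi -> R^d (R^d carries the product =
   Borel sigma-algebra, i.e. a map into R^d is measurable iff all its
   coordinates are). Stated as: composing G with measurable maps into
   R^d and Xi (from any measurable space) yields a measurable map. *)
Definition G_jointly_measurable {R : realType} {d : nat}
  {dX : measure_display} {Xi : measurableType dX}
  (G : 'rV[R]_d -> Xi -> 'rV[R]_d) : Prop :=
  forall (dT : measure_display) (T : measurableType dT)
         (h : T -> 'rV[R]_d) (eta : T -> Xi),
    (forall i, measurable_fun setT (fun t => h t 0 i)) ->
    measurable_fun setT eta ->
    forall i, measurable_fun setT (fun t => G (h t) (eta t) 0 i).

Definition mutually_independent {R : realType}
  {dO : measure_display} {Omega : measurableType dO}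
  {dX : measure_display} {Xi : measurableType dX}
  (P : probability Omega R) (xi : nat -> nat -> Omega -> Xi) : Prop :=
  forall (s : seq (nat * nat)) (A : nat * nat -> set Xi),
    uniq s -> (forall e, measurable (A e)) ->
    P [set w | forall e, e \in s -> A e (xi e.1 e.2 w)] =
    (\prod_(e <- s) P (xi e.1 e.2 @^-1` A e))%E.

Definition batchS {R : realType} (sigma2 eps : R) : nat :=
  maxn `|Num.ceil (sigma2 / eps)|%N 1.

Definition stepsize {R : realType} (L sigma2 eps : R) : R :=
  if sigma2 == 0 then L^-1
  else Order.min L^-1 (eps * (batchS sigma2 eps)%:R / (2 * L * sigma2)).

(* ---------- the fixed computation model: deterministic schedule ----------
   Workers are numbered 0..n-1 (worker i of the paper is worker i-1 here);
   worker i needs tau i seconds per stochastic gradient.  Since communication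
   is instantaneous, worker i never idles and its j-th gradient (j >= 1)
   arrives at the server at time j * tau i.  Arrivals are processed by the
   server one at a time, in order of arrival time; simultaneous arrivals
   are processed in increasing worker index. *)

Record sched_state := SchedState {
  done_w : nat -> nat;   (* number of gradients worker i has delivered *)
  tag_w  : nat -> nat;   (* iteration index k of the pair (x^k,k) worker i is
                            currently computing at *)
  srv_k  : nat;
  srv_cnt : nat          (* number of gradients accepted in iteration k *)
}.

Definition arrival_time {R : realType} (tau : nat -> R) (c : nat -> nat)
  (i : nat) : R := (c i).+1%:R * tau i.

Definition next_worker {R : realType} (n : nat) (tau : nat -> R)
  (c : nat -> nat) : nat :=
  let tmin := \big[Order.min/arrival_time tau c 0]_(i < n) arrival_time tau c i in
  find (fun i => arrival_time tau c i == tmin) (iota 0 n).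

Definition sched_init : sched_state :=
  SchedState (fun _ => 0%N) (fun _ => 0%N) 0%N 0%N.

Definition sched_step {R : realType} (n : nat) (tau : nat -> R) (S : nat)
  (s : sched_state) : sched_state :=
  let i := next_worker n tau (done_w s) in
  let accepted := (tag_w s i == srv_k s) in
  let cnt' := (srv_cnt s + accepted)%N in
  let finished := (cnt' == S) in
  SchedState
    (fun j => if j == i then (done_w s j).+1 else done_w s j)
    (* the worker is sent back the current pair (x^k,k), before a possible
       update to iteration k+1 *)
    (fun j => if j == i then srv_k s else tag_w s j)
    (if finished then (srv_k s).+1 else srv_k s)
    (if finished then 0%N else cnt').

Definition sched {R : realType} (n : nat) (tau : nat -> R) (S : nat)
  (m : nat) : sched_state := iter m (sched_step n tau S) sched_init.

(* time at which the (m+1)-th arrival (processed in step m) happens *)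
Definition event_time {R : realType} (n : nat) (tau : nat -> R) (S : nat)
  (m : nat) : R :=
  let c := done_w (sched n tau S m) in arrival_time tau c (next_worker n tau c).

(* ---------- the iterates (depend on the samples) ----------
   xi i j is the sample used by worker i for its j-th gradient (j >= 1). *)

Record run_state {R : realType} {d : nat} := RunState {
  xcur : 'rV[R]_d;
  gacc : 'rV[R]_d;
  hist : nat -> 'rV[R]_d        (* hist k' = x^k' for all k' <= k *)
}.
Arguments run_state : clear implicits.

Definition run_step {R : realType} {d : nat} {Xi : Type}
  (G : 'rV[R]_d -> Xi -> 'rV[R]_d) (xi : nat -> nat -> Xi) (gamma : R)
  (n : nat) (tau : nat -> R) (S : nat)
  (s : sched_state) (r : run_state R d) : run_state R d :=
  let i := next_worker n tau (done_w s) in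
  let j := (done_w s i).+1 in
  let g := G (hist r (tag_w s i)) (xi i j) in
  let accepted := (tag_w s i == srv_k s) in
  let g' := if accepted then gacc r + (S%:R)^-1 *: g else gacc r in
  let finished := ((srv_cnt s + accepted)%N == S) in
  if finished then
    let x' := xcur r - gamma *: g' in
    RunState x' 0 (fun k' => if k' == (srv_k s).+1 then x' else hist r k')
  else RunState (xcur r) g' (hist r).

Fixpoint run {R : realType} {d : nat} {Xi : Type}
  (G : 'rV[R]_d -> Xi -> 'rV[R]_d) (xi : nat -> nat -> Xi) (gamma : R)
  (n : nat) (tau : nat -> R) (S : nat) (x0 : 'rV[R]_d) (m : nat)
  : run_state R d :=
  match m with
  | 0 => RunState x0 0 (fun _ => x0)
  | m'.+1 => run_step G xi gamma n tau S (sched n tau S m')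
                      (run G xi gamma n tau S x0 m')
  end.

Definition rennala_term {R : realType} (tau : nat -> R) (L Delta eps sigma2 : R)
  (m : nat) : R :=
  (m%:R^-1 * \sum_(i < m) (tau i)^-1)^-1 *
  (L * Delta / eps + sigma2 * L * Delta / (m%:R * eps ^+ 2)).

Definition rennala_bound {R : realType} (n : nat) (tau : nat -> R)
  (L Delta eps sigma2 : R) : R :=
  96 * \big[Order.min/rennala_term tau L Delta eps sigma2 1]_(1 <= m < n.+1)
         rennala_term tau L Delta eps sigma2 m.

(* Main.v *)
Require Import Defs.
From HB Require Import structures.
From mathcomp Require Import all_boot all_order all_algebra.
From mathcomp Require Import all_classical all_reals all_analysis.
From mathcomp Require Import measurable_realfun.
From mathcomp Require Import zify ring lra.
Set Implicit Arguments. Unset Strict Implicit. Unset Printing Implicit Defensive.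
Import Order.TTheory GRing.Theory Num.Theory.
Import numFieldNormedType.Exports.
Local Open Scope classical_set_scope.
Local Open Scope ring_scope.

(* Time: in each iteration every worker wastes at most one (stale) arrival, so the q
   fastest workers deliver S accepted gradients within (S + 2 q) / sum_(i < q) 1 / tau i
   seconds of its start, the 2 q paying for the stale arrival and for rounding.

   Convergence: let x be the current iterate, c / S the accepted fraction of the batch and
   e the difference between the accumulated gradient and (c / S) grad f(x). The potential
     f(x) - f^* + L gamma^2 / 2 |e|^2 - gamma (1 - L gamma) <grad f(x), e>
       + gamma / 2 sum_(j < k) |grad f(x^j)|^2
   is nonnegative because |grad f(x)|^2 <= 2 L (f(x) - f^* ). An accepted gradient is
   unbiased given the past, so it raises the expected potential by at most
   L gamma^2 sigma^2 / (2 S^2), and by the descent lemma closing a batch does not raise it.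
   Summing over the arrivals bounds the expected sum of squared gradients. Conditioning on
   the past is Fubini's theorem on (past) x Xi, the past being the sigma-algebra generated
   by the samples already consumed. *)

(** * The arrival schedule *)

Lemma next_workerP (R : realType) (n : nat) (tau : nat -> R) (c : nat -> nat) :
  (0 < n)%N ->
  (next_worker n tau c < n)%N /\
  forall i, (i < n)%N ->
    arrival_time tau c (next_worker n tau c) <= arrival_time tau c i.
Proof.
move=> n0; rewrite /next_worker.
set F := arrival_time tau c; set tmin := \big[_/_]_(_ < n) _.
have hasmin : has (fun i => F i == tmin) (iota 0 n).
  suff [i i_n ->] : exists2 i, (i < n)%N & tmin = F i.
    by apply/hasP; exists i; rewrite ?mem_iota ?add0n ?eqxx.
  (* The default of the minimum is the arrival of worker 0, itself in range because [n] is
     positive. *)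
  apply: (big_ind (fun x => exists2 i, (i < n)%N & x = F i)).
  - exists 0%N; [exact: n0|by []].
  - move=> _ _ [i i_n ->] [j j_n ->].
    by rewrite /Order.min; case: ifP => _; [exists i|exists j].
  - move=> i _; exists (val i) => //; exact: ltn_ord.
have lt_n : (find (fun i => F i == tmin) (iota 0 n) < n)%N.
  by rewrite -[X in (_ < X)%N](size_iota 0 n) -has_find.
split=> // i i_n; have := nth_find 0%N hasmin.
rewrite nth_iota // add0n => /eqP ->.
exact: (bigmin_le (F 0%N) (Ordinal i_n) (fun i : 'I_n => F i)).
Qed.

Section Schedule.
Context (R : realType) (n : nat) (tau : nat -> R) (S : nat).
Hypothesis S_gt0 : (0 < S)%N.

Let st := sched n tau S.

Lemma schedS m : st m.+1 = sched_step n tau S (st m).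
Proof. by []. Qed.

Lemma srv_cnt_lt m : (srv_cnt (st m) < S)%N.
Proof.
elim: m => [|m IH] //; rewrite schedS /=.
set b := (tag_w _ _ == _); have := leq_b1 b.
by case: eqP => /=; move: (nat_of_bool b) IH S_gt0; lia.
Qed.

Hypotheses (n_gt0 : (0 < n)%N) (tau_gt0 : forall i, (i < n)%N -> 0 < tau i).

(** The last delivery of worker [i] is one of the first [m] events; [0 <= X] covers a worker that
    has delivered nothing. *)
Lemma done_w_le_event_time X m : 0 <= X ->
  (forall m', (m' < m)%N -> event_time n tau S m' <= X) ->
  forall i, (i < n)%N -> (done_w (st m) i)%:R * tau i <= X.
Proof.
move=> X0; elim: m => [|m IH] H i i_n; first by rewrite mul0r.
rewrite schedS /=; case: eqP => [->|_]; first exact: H.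
by apply: IH => // m' m'm; apply: H; lia.
Qed.

Lemma sum_done_w m : (\sum_(i < n) done_w (st m) i)%N = m.
Proof.
elim: m => [|m IH]; first by rewrite big1.
rewrite schedS /=.
have [lt_n _] := next_workerP tau (done_w (st m)) n_gt0.
rewrite (bigD1 (Ordinal lt_n)) //= eqxx addSn; congr _.+1.
rewrite -[RHS]IH [RHS](bigD1 (Ordinal lt_n)) //=; congr addn.
apply: eq_bigr => i ni; case: eqP => // e.
by move/eqP: ni; case; apply: val_inj.
Qed.

(* A worker's first arrival in an iteration may carry a stale gradient; all the later ones
   are accepted. *)
Lemma accepted_ge a m : (a <= m)%N ->
  (forall m', (a <= m' <= m)%N -> srv_k (st m') = srv_k (st a)) ->
  (forall i, (done_w (st a) i < done_w (st m) i)%N -> tag_w (st m) i = srv_k (st a)) /\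
  (\sum_(i < n) (done_w (st m) i - done_w (st a) i - 1) <= srv_cnt (st m))%N /\
  (forall i, (done_w (st a) i <= done_w (st m) i)%N).
Proof.
elim: m => [|m IH].
  rewrite leqn0 => /eqP -> _; split=> [i|]; first by rewrite ltnn.
  by split=> //; rewrite big1 // => i _; rewrite subnn.
rewrite leq_eqVlt => /orP[/eqP <- _|].
  split=> [i|]; first by rewrite ltnn.
  by split=> //; rewrite big1 // => i _; rewrite subnn.
rewrite ltnS => am Hk.
have [|Ht [Hs Hd]] := IH am; first by move=> m' ?; apply: Hk; lia.
have km : srv_k (st m) = srv_k (st a) by apply: Hk; lia.
have km1 : srv_k (st m.+1) = srv_k (st a) by apply: Hk; lia.
have [lt_n _] := next_workerP tau (done_w (st m)) n_gt0.
move: km1; rewrite schedS /=.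
set w := next_worker _ _ _; set cnt' := (_ + _)%N.
(* A full batch would advance [srv_k] at this arrival, but the iteration is still that of [a]. *)
have [_|_ _] := eqVneq cnt' S; first by rewrite km => /eqP; lia.
split=> [i|]; first by have [-> //|_ /Ht] := eqVneq i w.
split; last by move=> i; have := Hd i; have [->|] := eqVneq i w; lia.
rewrite (bigD1 (Ordinal lt_n)) //= eqxx.
move: Hs; rewrite (bigD1 (Ordinal lt_n)) //= -/w.
set s1 := (\sum_(_ < n | _) _)%N => Hs.
rewrite (_ : (\sum_(_ < n | _) _)%N = s1); last first.
  apply: eq_bigr => i ni; case: eqP => // e.
  by move/eqP: ni; case; apply: val_inj.
(* On the first arrival of [w] since [a] the truncated subtraction still gives 0; a later one
   carries the current tag, so the counter grows along with the sum. *)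
have := Hd w; rewrite leq_eqVlt => /orP[/eqP e|lt]; first by rewrite /cnt'; lia.
by rewrite /cnt' (Ht w lt) km eqxx; lia.
Qed.

Lemma srv_k_step m : srv_k (st m.+1) = srv_k (st m) \/
  srv_k (st m.+1) = (srv_k (st m)).+1 /\ srv_cnt (st m.+1) = 0%N.
Proof. by rewrite schedS /=; case: eqP; [right|left]. Qed.

(** Of [n + S] arrivals within one iteration at most [n] are stale, so the batch must close before
    then. *)
Lemma iteration_ends a : exists2 m, (a <= m)%N &
  (forall m', (a <= m' <= m)%N -> srv_k (st m') = srv_k (st a)) /\
  srv_k (st m.+1) = (srv_k (st a)).+1 /\ srv_cnt (st m.+1) = 0%N.
Proof.
have [[m am neq]|Heq] := pselect (exists2 m, (a <= m)%N & srv_k (st m) != srv_k (st a)).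
  have ex : exists m, (a <= m)%N && (srv_k (st m) != srv_k (st a)).
    by exists m; rewrite am.
  case: (ex_minnP ex) => p /andP[ap nep minp].
  have ltap : (a < p)%N.
    by rewrite ltn_neqAle ap andbT; apply: contraNneq nep => ->.
  case: p ap nep minp ltap => // p _ nep minp; rewrite ltnS => ap.
  have same m' : (a <= m' <= p)%N -> srv_k (st m') = srv_k (st a).
    move=> /andP[am' m'p]; apply/eqP; apply: contraLR m'p => ne.
    by rewrite -ltnNge; apply: minp; rewrite am'.
  exists p => //; split=> //; have kp : srv_k (st p) = srv_k (st a) by apply: same; rewrite ap /=.
  have [e|[e1 e2]] := srv_k_step p; first by rewrite e kp eqxx in nep.
  by rewrite e1 kp.
have same m : (a <= m)%N -> srv_k (st m) = srv_k (st a).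
  by move=> am; apply/eqP/negPn/negP => ne; apply: Heq; exists m.
have am : (a <= a + n + S)%N by lia.
have [|_ [Hs Hd]] := accepted_ge am; first by move=> m' /andP[/same].
have Hc := srv_cnt_lt (a + n + S).
have : (\sum_(i < n) done_w (st (a + n + S)) i <=
   \sum_(i < n) (done_w (st (a + n + S)) i - done_w (st a) i - 1) +
   (\sum_(i < n) done_w (st a) i + n))%N.
  rewrite -[X in (_ <= _ + (_ + X))%N](card_ord n) -sum1_card -!big_split.
  by apply: leq_sum => i _ /=; have := Hd i; lia.
by rewrite !sum_done_w; lia.
Qed.

(** Were an arrival of iteration [k] later than [(k + 1) T], each worker [i < q] would have made at
    least [T / tau i - 1] deliveries since the iteration began, hence at least [T / tau i - 2]
    accepted ones. These add up to [S], but an open batch holds fewer. *)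
Lemma iteration_time (q : nat) (k : nat) : (0 < q <= n)%N ->
  let T := (S%:R + 2 * q%:R) / \sum_(i < q) (tau i)^-1 in
  exists m, [/\ srv_k (st m) = k, srv_cnt (st m) = 0%N &
    forall m', (m' < m)%N -> event_time n tau S m' <= k%:R * T].
Proof.
move=> /andP[q_gt0 q_n] T.
have sum_gt0 : 0 < \sum_(i < q) (tau i)^-1.
  rewrite (bigD1 (Ordinal q_gt0)) //= ltr_wpDr //; last by rewrite invr_gt0 tau_gt0 //; lia.
  by rewrite sumr_ge0 // => i _; rewrite invr_ge0 ltW // tau_gt0 // (leq_trans _ q_n).
have T_ge0 : 0 <= T by rewrite divr_ge0 ?(ltW sum_gt0) // addr_ge0 ?mulr_ge0.
elim: k => [|k [a [ka ca Ha]]]; first by exists 0%N.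
have [m am [same [k' c']]] := iteration_ends a.
exists m.+1; split; [by rewrite k' ka|by []|] => m' m'm.
have [m'a|am'] := ltnP m' a.
  by apply: le_trans (Ha _ m'a) _; rewrite ler_wpM2r // ler_nat.
rewrite leNgt; apply/negP => late.
have [|_ [Hs Hd]] := @accepted_ge a m' am'; first by move=> m'' ?; apply: same; lia.
have [lt_n Hmin] := next_workerP tau (done_w (st m')) n_gt0.
have kT0 : 0 <= k%:R * T by rewrite mulr_ge0.
have Hw (i : 'I_q) : T * (tau i)^-1 - 2 <=
    (done_w (st m') i - done_w (st a) i - 1)%:R.
  have i_n : (i < n)%N by rewrite (leq_trans _ q_n).
  have t0 := tau_gt0 i_n.
  have ci := done_w_le_event_time kT0 Ha i_n.
  (* The late event is the earliest pending arrival, so the next delivery of every worker is late as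
     well. *)
  have : k.+1%:R * T < (done_w (st m') i).+1%:R * tau i.
    exact: lt_le_trans late (Hmin _ i_n).
  have H1 : T + (done_w (st a) i)%:R * tau i < (done_w (st m') i).+1%:R * tau i -> 
     T * (tau i)^-1 - 2 <= (done_w (st m') i - done_w (st a) i - 1)%:R.
    rewrite -(ltr_pM2r (_ : 0 < (tau i)^-1)) ?invr_gt0 // mulrDl !mulfK ?gt_eqF //.
    move=> H2; have : (done_w (st m') i <= (done_w (st m') i - done_w (st a) i - 1) + (done_w (st a) i + 1))%N.
      by lia.
    by rewrite -(ler_nat R) !natrD; move: H2; rewrite -natr1; lra.
  move=> H2; apply: H1; move: H2; rewrite -natr1 mulrDl mul1r; lra.
have HS : S%:R <= \sum_(i < q) (T * (tau i)^-1 - 2).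
  rewrite big_split /= -mulr_sumr /T divfK ?gt_eqF // sumr_const card_ord mulNrn -(mulr_natr 2%R).
  by lra.
have : (S%:R : R) <= (srv_cnt (st m'))%:R.
  apply: (le_trans HS); apply: (le_trans (ler_sum _ (fun i _ => Hw i))).
  rewrite -natr_sum ler_nat (leq_trans _ Hs) //.
  pose F i := (done_w (st m') i - done_w (st a) i - 1)%N.
  rewrite (big_ord_widen n F q_n) [leqRHS](bigID (fun i : 'I_n => (i < q)%N)) /=.
  exact: leq_addr.
by rewrite ler_nat; have := srv_cnt_lt m'; lia.
Qed.

End Schedule.

(** * Smooth functions *)

Definition dotp {R : realType} {d : nat} (u v : 'rV[R]_d) : R :=
  \sum_(i < d) u 0 i * v 0 i.

Section DotProduct.
Context (R : realType) (d : nat).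
Implicit Types (u v w : 'rV[R]_d) (a : R).

Lemma dotpC u v : dotp u v = dotp v u.
Proof. by apply: eq_bigr => i _; rewrite mulrC. Qed.

Lemma dotpDl u v w : dotp (u + v) w = dotp u w + dotp v w.
Proof. by rewrite -big_split; apply: eq_bigr => i _; rewrite mxE mulrDl. Qed.

Lemma dotpZl a u v : dotp (a *: u) v = a * dotp u v.
Proof. by rewrite mulr_sumr; apply: eq_bigr => i _; rewrite mxE mulrA. Qed.

Lemma dotpNl u v : dotp (- u) v = - dotp u v.
Proof. by rewrite -scaleN1r dotpZl mulN1r. Qed.

Lemma dotpDr u v w : dotp w (u + v) = dotp w u + dotp w v.
Proof. by rewrite dotpC dotpDl !(dotpC _ w). Qed.

Lemma dotpZr a u v : dotp u (a *: v) = a * dotp u v.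
Proof. by rewrite dotpC dotpZl dotpC. Qed.

Lemma dotp0l u : dotp 0 u = 0.
Proof. by rewrite -(scale0r 0) dotpZl mul0r. Qed.

Lemma dotp0r u : dotp u 0 = 0.
Proof. by rewrite dotpC dotp0l. Qed.

Lemma sqnormE u : sqnorm u = dotp u u.
Proof. by apply: eq_bigr => i _; rewrite expr2. Qed.

Lemma sqnorm_ge0 u : 0 <= sqnorm u.
Proof. by apply: sumr_ge0 => i _; exact: sqr_ge0. Qed.

Lemma sqnorm0 : sqnorm (0 : 'rV[R]_d) = 0.
Proof. by rewrite sqnormE dotp0l. Qed.

Lemma sqnormD u v : sqnorm (u + v) = sqnorm u + 2 * dotp u v + sqnorm v.
Proof. rewrite !sqnormE !dotpDl !dotpDr (dotpC v u); ring. Qed.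

Lemma sqnormZ a u : sqnorm (a *: u) = a ^+ 2 * sqnorm u.
Proof. by rewrite !sqnormE dotpZl dotpZr mulrA. Qed.

Lemma enorm_ge0 u : 0 <= enorm u.
Proof. exact: sqrtr_ge0. Qed.

Lemma sqr_enorm u : enorm u ^+ 2 = sqnorm u.
Proof. by rewrite sqr_sqrtr ?sqnorm_ge0. Qed.

Lemma enormZ a u : enorm (a *: u) = `|a| * enorm u.
Proof. by rewrite /enorm sqnormZ sqrtrM ?sqr_ge0 // sqrtr_sqr. Qed.

(** Cauchy-Schwarz inequality, from the nonnegativity of the quadratic [sqnorm (u + t *: v)] in
    [t]. *)
Lemma dotp_le_enorm u v : dotp u v <= enorm u * enorm v.
Proof.
have quad t : 0 <= sqnorm u + 2 * t * dotp u v + t ^+ 2 * sqnorm v.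
  have := sqnorm_ge0 (u + t *: v); rewrite sqnormD dotpZr sqnormZ; lra.
have [v0|v0] := eqVneq (sqnorm v) 0.
  rewrite {2}/enorm v0 sqrtr0 mulr0 leNgt; apply/negP => H.
  (* With [v] of norm zero the quadratic is affine in [t]; this [t] would bring it to -1. *)
  pose t := - (sqnorm u + 1) / (2 * dotp u v).
  have e : 2 * t * dotp u v = - (sqnorm u + 1) by rewrite /t; field; rewrite gt_eqF.
  by have := quad t; rewrite v0 e; lra.
have vp : 0 < sqnorm v by rewrite lt_neqAle eq_sym v0 sqnorm_ge0.
have ev : 0 < enorm v by rewrite sqrtr_gt0.
have [d0|d0] := ltP 0 (dotp u v); last by rewrite (le_trans d0) ?mulr_ge0 ?enorm_ge0.
rewrite -(@ler_pXn2r _ 2) ?nnegrE ?mulr_ge0 ?enorm_ge0 ?(ltW d0) // exprMn !sqr_enorm.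
pose t := - dotp u v / sqnorm v.
have e : sqnorm u + 2 * t * dotp u v + t ^+ 2 * sqnorm v =
    (sqnorm u * sqnorm v - dotp u v ^+ 2) / sqnorm v by rewrite /t; field.
by have := quad t; rewrite e pmulr_lge0 ?invr_gt0 // subr_ge0.
Qed.

Lemma normr_coord_le_enorm u i : `|u 0 i| <= enorm u.
Proof.
rewrite -sqrtr_sqr ler_sqrt ?sqnorm_ge0 // /sqnorm (bigD1 i) //= lerDl.
by apply: sumr_ge0 => j _; exact: sqr_ge0.
Qed.

Lemma normr_coord_le_norm u i : `|u 0 i| <= `|u|.
Proof.
rewrite [leRHS]/Num.norm /= mx_normrE.
exact: (le_bigmax (0 : R) (fun ij : 'I_1 * 'I_d => `|u ij.1 ij.2|) (0, i)).
Qed.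

(** [L_smooth] uses the Euclidean norm, the topology of row vectors the maximum norm; continuity of
    the gradient needs this comparison. *)
Lemma enorm_le_norm u : enorm u <= Num.sqrt d%:R * `|u|.
Proof.
have -> : `|u| = Num.sqrt (`|u| ^+ 2) by rewrite sqrtr_sqr normr_id.
rewrite -sqrtrM // ler_sqrt ?mulr_ge0 ?sqr_ge0 //.
rewrite mulr_natl -[X in _ *+ X]card_ord -sumr_const.
by apply: ler_sum => i _; rewrite -real_normK ?num_real // lerXn2r ?nnegrE // normr_coord_le_norm.
Qed.

End DotProduct.

Section Smooth.
Context (R : realType) (d : nat) (f : 'rV[R]_d -> R) (L : R).
Hypotheses (df : forall x, differentiable f x) (Lf : L_smooth L f).

Lemma diff_gradient x v : 'd f x v = dotp (gradient f x) v.
Proof.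
rewrite {1}[v]row_sum_delta linear_sum; apply: eq_bigr => i _.
by rewrite linearZ mxE mulrC.
Qed.

Lemma is_derive_line x v (t : R) :
  is_derive t (1 : R) (fun s : R => f (x + s *: v)) (dotp (gradient f (x + t *: v)) v).
Proof.
have dh : is_diff t (fun s : R => x + s *: v) (fun s : R => s *: v).
  have e : 0 + ( *:%R^~ v) = (fun s : R => s *: v) by apply/funext => s; exact: add0r.
  exact: (@is_diff_eq _ _ _ (fun s : R => x + s *: v) _ _ _
    (is_diffD (is_diff_cst x t) (is_diff_scalel t v)) e).
have dfh := is_diff_comp dh (differentiableP (df (x + t *: v))).
apply: DeriveDef; first exact/diff_derivable.
by rewrite deriveE // diff_val /= scale1r diff_gradient.
Qed.

(** Mean value theorem on [0, 1] for [g], the difference between [f] along the segment and its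
    quadratic upper model; Cauchy-Schwarz and the Lipschitz gradient make [g'] nonpositive there. *)
Lemma descent x v : f (x + v) <= f x + dotp (gradient f x) v + L / 2 * sqnorm v.
Proof.
have halve (a b c : R) : a / 2 * b * (2 * c) = a * b * c by field.
pose g t := f (x + t *: v) - t * dotp (gradient f x) v - L / 2 * sqnorm v * t ^+ 2.
pose g' t := dotp (gradient f (x + t *: v)) v - dotp (gradient f x) v - L * sqnorm v * t.
have dg (t : R) : is_derive t (1 : R) g (g' t).
  have ? := is_derive_line x v t.
  rewrite (_ : g = (fun s => f (x + s *: v)) - dotp (gradient f x) v *: id
    - (L / 2 * sqnorm v) *: (id ^+ 2)); last first.
    by apply/funext => s; rewrite /g /= !fctE /= [s * _]mulrC.
  apply: is_derive_eq; have scE (a b : R) : a *: (b : R^o) = a * b by [].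
  rewrite /g' !scE expr1 !mulr1.
  by congr (_ - _); exact: halve.
have [|c c01] := @MVT_segment R g g' 0 1 ler01 (fun t _ => dg t).
  apply: derivable_within_continuous => t _; apply: ex_derive.
rewrite subr0 mulr1 /g scale1r scale0r addr0 !mul0r !mul1r.
suff : g' c <= 0 by rewrite expr0n expr1n /= !mulr0 mulr1; lra.
have c0 : 0 <= c by move: c01; rewrite in_itv => /andP[].
rewrite /g' -dotpNl -dotpDl.
apply: le_trans (_ : _ <= enorm (gradient f (x + c *: v) - gradient f x) * enorm v - L * sqnorm v * c) _.
  by rewrite lerD2r dotp_le_enorm.
have := Lf (x + c *: v) x; rewrite (_ : x + c *: v - x = c *: v); last by rewrite addrC addKr.
rewrite enormZ (ger0_norm c0) => H.
have := ler_wpM2r (enorm_ge0 v) H; rewrite -sqr_enorm.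
by move: (enorm (_ - _)) (enorm v) => e N; lra.
Qed.

(** Compare [fstar] with the value of [f] after a gradient step of stepsize [1 / L]. *)
Lemma sqnorm_gradient_le fstar x : 0 < L -> (forall y, fstar <= f y) ->
  sqnorm (gradient f x) <= 2 * L * (f x - fstar).
Proof.
move=> L0 Hf; have := descent x (- L^-1 *: gradient f x).
rewrite dotpZr -sqnormE sqnormZ => H1; have H2 := Hf (x + - L^-1 *: gradient f x).
have H : fstar <= f x - (2 * L)^-1 * sqnorm (gradient f x).
  apply: (le_trans H2); apply: (le_trans H1).
  rewrite le_eqVlt; apply/orP; left; apply/eqP; field; lra.
have : 2 * L * ((2 * L)^-1 * sqnorm (gradient f x)) <= 2 * L * (f x - fstar).
  by apply: ler_wpM2l; lra.
by rewrite mulVKf //; lra.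
Qed.

End Smooth.


(** * Measurability of functions of a random vector *)

(** Open sets are reached through balls of the maximum norm: the preimage of a ball is a finite
    intersection of coordinate conditions, and an open set is a countable union of balls with
    rational centre and radius. *)
Lemma measurable_continuous_comp (R : realType) (d : nat) (dT : measure_display)
  (T : measurableType dT) (h : T -> 'rV[R]_d) (g : 'rV[R]_d -> R) :
  (forall i, measurable_fun setT (fun t => h t 0 i)) -> continuous g ->
  measurable_fun setT (g \o h).
Proof.
move=> mh cg.
have mball (q : 'rV[R]_d) (r : R) : 0 < r -> measurable (h @^-1` ball q r).
  move=> r0.
  rewrite (_ : _ @^-1` _ = \bigcap_(i in [set: 'I_d]) ((fun t => h t 0 i) @^-1` ball (q 0 i) r)).
    apply: fin_bigcap_measurable => // i _.
    by rewrite -[X in measurable X]setTI; apply: mh => //; apply: open_measurable; exact: ball_open.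
  apply/seteqP; split=> t /=; first by move=> [_ H] i _; exact: H.
  by move=> H; split=> // i j; rewrite (ord1 i); exact: H.
have mopen A : open A -> measurable (h @^-1` A).
  move=> oA.
  pose D : set ('rV[rat]_d * rat) :=
    [set p | 0 < p.2 /\ ball (map_mx ratr p.1 : 'rV[R]_d) (ratr p.2) `<=` A].
  rewrite (_ : _ @^-1` _ = \bigcup_(p in D) (h @^-1` ball (map_mx ratr p.1 : 'rV[R]_d) (ratr p.2))).
    rewrite bigcup_mkcond; apply: countable_bigcupT_measurable; first exact: countableP.
    by move=> p; case: ifPn => // /set_mem[p0 _]; apply: mball; rewrite ltr0q.
  apply/seteqP; split=> [t /= At|t [p [_ pA]]]; last exact: pA.
  have /nbhs_ballP[e /= e0 eA] := open_nbhs_nbhs (conj oA At).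
  (* A radius below [e / 2]: the rational ball containing [h t] then stays inside the [e]-ball
     around [h t]. *)
  have [q /[!in_itv]/= /andP[q0 qe]] := rat_in_itvoo (divr_gt0 e0 (ltr0n R 2)).
  have /choice[c Hc] (i : 'I_d) : exists c : rat, ball (ratr c : R) (ratr q) (h t 0 i).
    have [c /[!in_itv]/= /andP[c1 c2]] := @rat_in_itvoo R (h t 0 i - ratr q) (h t 0 i) ltac:(lra).
    by exists c; rewrite /ball /= ltr_norml; lra.
  have tball : ball (map_mx ratr (\row_i c i) : 'rV[R]_d) (ratr q) (h t).
    by split=> // i j; rewrite (ord1 i) !mxE; exact: Hc.
  exists (\row_i c i, q) => //=; split; first by rewrite /= -(ltr0q R).
  move=> y yball; apply: eA.
  apply: (@le_ball _ _ _ (ratr q + ratr q)); first by lra.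
  exact: (ball_triangle (ball_sym tball)).
move=> _; apply: (measurability _ (RGenOpens.measurableE R)) => //.
move=> _ [_ [a [b ->] <-]]; rewrite setTI comp_preimage; apply: mopen.
by apply: open_comp => [? _|]; [exact: cg|exact: interval_open].
Qed.

Lemma continuous_gradient_coord (R : realType) (d : nat) (L : R)
  (f : 'rV[R]_d -> R) (i : 'I_d) :
  L_smooth L f -> continuous (fun x => gradient f x 0 i).
Proof.
move=> Lf x; pose C := `|L| * Num.sqrt d%:R + 1.
have C0 : 0 < C by rewrite ltr_wpDl // mulr_ge0 ?sqrtr_ge0.
move=> A /nbhs_ballP[e /= e0 eA].
apply/nbhs_ballP; exists (e / C) => [|y]; first exact: divr_gt0.
rewrite -ball_normE /= ltr_pdivlMr // => H; apply: eA; rewrite -ball_normE /=.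
have coordB (u v : 'rV[R]_d) : (u - v) 0 i = u 0 i - v 0 i by rewrite !mxE.
rewrite -coordB; apply: le_lt_trans (normr_coord_le_enorm _ i) _.
apply: le_lt_trans (Lf x y) _; apply: le_lt_trans H.
apply: (@le_trans _ _ (`|L| * enorm (x - y))).
  by rewrite ler_wpM2r ?enorm_ge0 // ler_norm.
apply: (@le_trans _ _ (`|L| * (Num.sqrt d%:R * `|x - y|))).
  by rewrite ler_wpM2l // enorm_le_norm.
rewrite mulrA [leRHS]mulrC ler_wpM2r // /C lerDl; exact: ler01.
Qed.

Lemma measurable_dotp (R : realType) (d : nat) (dT : measure_display)
  (T : measurableType dT) (u v : T -> 'rV[R]_d) :
  (forall i, measurable_fun setT (fun t => u t 0 i)) ->
  (forall i, measurable_fun setT (fun t => v t 0 i)) ->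
  measurable_fun setT (fun t => dotp (u t) (v t)).
Proof.
move=> mu mv; apply: measurable_sum => i; exact: measurable_funM.
Qed.

Lemma measurable_sqnorm (R : realType) (d : nat) (dT : measure_display)
  (T : measurableType dT) (u : T -> 'rV[R]_d) :
  (forall i, measurable_fun setT (fun t => u t 0 i)) ->
  measurable_fun setT (fun t => sqnorm (u t)).
Proof.
move=> mu; apply: measurable_sum => i; exact: measurable_funX.
Qed.

(** * The potential *)

(* Failed conversions would otherwise unfold the Frechet derivative and not terminate. *)
Local Opaque gradient sqnorm dotp.

Section Potential.
Context (R : realType) (d : nat) (Xi : Type).
Context (f : 'rV[R]_d -> R) (G : 'rV[R]_d -> Xi -> 'rV[R]_d).
Context (L fstar gamma : R) (n : nat) (tau : nat -> R) (S : nat).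
Implicit Types (s : sched_state) (r : run_state R d).

Definition grad_error s r : 'rV[R]_d :=
  gacc r - ((srv_cnt s)%:R / S%:R) *: gradient f (xcur r).

(** These are the terms in [e] that the descent lemma produces for the step to
    [x - gamma *: (gradient f x + e)]. *)
Definition error_energy (x e : 'rV[R]_d) : R :=
  L * gamma ^+ 2 / 2 * sqnorm e - gamma * (1 - L * gamma) * dotp (gradient f x) e.

Definition past_gradients (h : nat -> 'rV[R]_d) (k : nat) : R :=
  \sum_(j < k) sqnorm (gradient f (h j)).

Definition potential s r : R :=
  f (xcur r) - fstar + error_energy (xcur r) (grad_error s r)
  + gamma / 2 * past_gradients (hist r) (srv_k s).

Definition noise (x : 'rV[R]_d) (z : Xi) : 'rV[R]_d := G x z - gradient f x.

(** The gradient of [error_energy] in [e], divided by [S] because an accepted gradient shifts the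
    error by its noise over [S]. *)
Definition slope s r : 'rV[R]_d :=
  (L * gamma ^+ 2 / S%:R) *: grad_error s r
  - (gamma * (1 - L * gamma) / S%:R) *: gradient f (xcur r).

Lemma past_gradientsS h k x :
  past_gradients (fun j => if j == k.+1 then x else h j) k.+1 =
  past_gradients h k + sqnorm (gradient f (h k)).
Proof.
rewrite /past_gradients big_ord_recr /= (ltn_eqF (ltnSn k)).
apply: (congr1 (+%R^~ _)); apply: eq_bigr => j _.
have /ltn_eqF -> : (j < k.+1)%N by have := ltn_ord j; lia.
reflexivity.
Qed.

Lemma past_gradients_ge0 h k : 0 <= past_gradients h k.
Proof. by apply: sumr_ge0 => j _; exact: sqnorm_ge0. Qed.

Lemma past_gradients0 h : past_gradients h 0 = 0.
Proof. exact: big_ord0. Qed.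

Local Opaque past_gradients.

Hypotheses (L_gt0 : 0 < L) (gamma_ge0 : 0 <= gamma) (Lgamma_le1 : L * gamma <= 1).
Hypotheses (S_gt0 : (0 < S)%N) (fstarP : forall x, fstar <= f x).
Hypotheses (df : forall x, differentiable f x) (Lf : L_smooth L f).

Lemma error_energyD x e v : error_energy x (e + v) = error_energy x e +
  dotp ((L * gamma ^+ 2) *: e - (gamma * (1 - L * gamma)) *: gradient f x) v
  + L * gamma ^+ 2 / 2 * sqnorm v.
Proof.
rewrite /error_energy sqnormD dotpDr dotpDl dotpNl !dotpZl.
move: (sqnorm e) (dotp e v) (sqnorm v) (dotp (gradient f x) e) (dotp (gradient f x) v).
by move=> *; field.
Qed.

(** With [a] and [b] the norms of [gradient f x] and [e], the gradient bound and Cauchy-Schwarz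
    leave at least [(a - L * gamma * b) ^+ 2 / (2 * L)]. *)
Lemma gap_error_energy_ge0 x e :
  0 <= f x - fstar + error_energy x e.
Proof.
have := sqnorm_gradient_le df Lf x L_gt0 fstarP.
rewrite /error_energy -!sqr_enorm.
have := dotp_le_enorm (gradient f x) e.
move: (enorm_ge0 (gradient f x)) (enorm_ge0 e).
move: (dotp _ e) (enorm (gradient f x)) (enorm e) (f x - fstar) => p a b F a0 b0 pab aF.
have H1 : gamma * (1 - L * gamma) * p <= gamma * (a * b).
  apply: (@le_trans _ _ (gamma * (1 - L * gamma) * (a * b))).
    by rewrite ler_wpM2l // mulr_ge0 // subr_ge0.
  rewrite ler_wpM2r ?mulr_ge0 // ler_piMr // lerBlDr lerDl mulr_ge0 // ltW //.
have H2 : a ^+ 2 / (2 * L) <= F by rewrite ler_pdivrMr ?mulr_gt0 // mulrC.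
have H3 : a ^+ 2 / (2 * L) + L * gamma ^+ 2 / 2 * b ^+ 2 - gamma * (a * b) =
   (a - L * gamma * b) ^+ 2 / (2 * L) by field; rewrite gt_eqF.
have H4 : 0 <= (a - L * gamma * b) ^+ 2 / (2 * L).
  by rewrite divr_ge0 ?sqr_ge0 // mulr_ge0 // ltW.
lra.
Qed.

Lemma past_gradients_le_potential s r :
  gamma / 2 * past_gradients (hist r) (srv_k s) <= potential s r.
Proof. by rewrite /potential lerDr gap_error_energy_ge0. Qed.

Lemma potential_ge0 s r : 0 <= potential s r.
Proof.
apply: le_trans (past_gradients_le_potential s r).
by rewrite mulr_ge0 ?divr_ge0 ?past_gradients_ge0.
Qed.

(* Completing a batch costs nothing: the descent lemma turns the error energy into
   decrease of [f]. *)
Lemma batch_descent x e :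
  f (x - gamma *: (gradient f x + e)) - fstar + gamma / 2 * sqnorm (gradient f x)
  <= f x - fstar + error_energy x e.
Proof.
have := descent df Lf x (- gamma *: (gradient f x + e)).
rewrite scaleNr -scaleNr dotpZr dotpDr -sqnormE sqnormZ sqnormD /error_energy scaleNr.
move: (f (x - _)) => F.
have : 0 <= gamma / 2 * (1 - L * gamma) * sqnorm (gradient f x).
  by rewrite !mulr_ge0 ?sqnorm_ge0 ?subr_ge0 // invr_ge0.
move: (sqnorm (gradient f x)) (dotp (gradient f x) e) (sqnorm e) (f x) => a b c F0 H1 H2.
rewrite sqrrN in H2.
rewrite -subr_ge0 in H2; rewrite -subr_ge0.
(* The difference is the slack of the descent lemma plus a multiple of the squared gradient,
   nonnegative since [L * gamma <= 1]. *)
have -> : F0 - fstar + (L * gamma ^+ 2 / 2 * c - gamma * (1 - L * gamma) * b) -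
    (F - fstar + gamma / 2 * a) =
   (F0 + - gamma * (a + b) + L / 2 * (gamma ^+ 2 * (a + 2 * b + c)) - F) +
   gamma / 2 * (1 - L * gamma) * a by field.
exact: addr_ge0.
Qed.

(** A step reads a single sample, so the constant stream [z] stands for it;
    [hist r (srv_k s) = xcur r] places an accepted gradient at the current iterate. The second-order
    expansion of [error_energy] is exact. *)
Lemma potential_step s r z :
  (srv_cnt s < S)%N -> hist r (srv_k s) = xcur r ->
  potential (sched_step n tau S s) (run_step G (fun _ _ => z) gamma n tau S s r) <=
  potential s r +
  (if tag_w s (next_worker n tau (done_w s)) == srv_k s then
     dotp (slope s r) (noise (xcur r) z) +
     L * gamma ^+ 2 / (2 * S%:R ^+ 2) * sqnorm (noise (xcur r) z)
   else 0).
Proof.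
move=> cS hx; have S0 : (S%:R : R) != 0 by rewrite pnatr_eq0; lia.
rewrite /potential /grad_error /run_step /sched_step /= -/(grad_error s r).
set w := next_worker _ _ _; have [e|ne] := eqVneq (tag_w s w) (srv_k s); last first.
  have -> : (srv_cnt s + false == S)%N = false by apply/eqP; lia.
  by rewrite /= addr0 addn0.
rewrite e.
set g := gacc r + _.
have eg : g - ((srv_cnt s).+1%:R / S%:R) *: gradient f (xcur r) =
    grad_error s r + S%:R^-1 *: noise (xcur r) z.
  rewrite /g /grad_error hx /noise scalerBr -natr1 mulrDl scalerDl mul1r.
  by rewrite opprD !addrA; congr (_ - _); rewrite -!addrA; congr (_ + _); rewrite addrC.
have eE : error_energy (xcur r) (g - ((srv_cnt s).+1%:R / S%:R) *: gradient f (xcur r)) =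
   error_energy (xcur r) (grad_error s r) + (dotp (slope s r) (noise (xcur r) z) +
     L * gamma ^+ 2 / (2 * S%:R ^+ 2) * sqnorm (noise (xcur r) z)).
  rewrite eg error_energyD dotpZr sqnormZ /slope !dotpDl !dotpNl !dotpZl -addrA; congr (_ + _).
  move: (dotp _ _) (dotp _ _) (sqnorm _) => a b c; field; exact: S0.
rewrite addn1; have [SE|_] /= := eqVneq (srv_cnt s).+1 S; last first.
  by rewrite /= eE; lra.
(* Closing the batch resets the error to 0 and adds one squared gradient to the sum; [batch_descent]
   accounts for both. *)
rewrite past_gradientsS hx mul0r scale0r subr0.
rewrite {1}/error_energy sqnorm0 dotp0r !mulr0 subr0 addr0.
move: eE; rewrite SE divff // scale1r => eE.
have := batch_descent (xcur r) (g - gradient f (xcur r)).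
rewrite eE [X in xcur r - gamma *: X]addrC subrK; lra.
Qed.

End Potential.

(** * Conditioning on the past *)

(** Both sides are finite measures in [A] that agree on the intersection-stable class [C], hence on
    the sigma-algebra it generates. *)
Lemma g_sigma_algebra_indep (R : realType) (dO dX : measure_display)
  (Omega : measurableType dO) (Xi : measurableType dX)
  (P : probability Omega R) (D : probability Xi R)
  (C : set (set Omega)) (eta : Omega -> Xi) (B : set Xi) :
  C `<=` measurable -> setI_closed C -> C setT ->
  measurable_fun setT eta -> measurable B ->
  (forall A, C A -> P (A `&` eta @^-1` B) = (P A * D B)%E) ->
  forall A, <<s C >> A -> P (A `&` eta @^-1` B) = (P A * D B)%E.
Proof.
move=> Cm CI CT meta mB H A CA.
have mE : measurable (eta @^-1` B) by rewrite -[X in measurable X]setTI; exact: meta.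
have [r Dr] : exists r : {nonneg R}, D B = r%:num%:E.
  have fD : D B \is a fin_num by exact: fin_num_measure.
  have r0 : 0 <= fine (D B) by exact: fine_ge0.
  by exists (NngNum r0); rewrite /= fineK.
rewrite Dr muleC.
apply: (@g_sigma_algebra_measure_unique _ R Omega C Cm (fun=> setT) _ _
  (mrestr P mE) (mscale r P)) => //.
- by rewrite bigcup_const //; exists 0%N.
- by move=> X CX; rewrite [LHS](H _ CX) Dr muleC.
- move=> _; 
  rewrite /= /mrestr; apply: le_lt_trans (probability_le1 _ _) (ltry _).
  exact: measurableI.
Qed.

(** The rectangle condition identifies the law of [(X, eta)] with the product of the law of [X] and
    [D]; Tonelli's theorem does the rest. *)
Lemma ge0_integral_indep (R : realType) (dO dT dX : measure_display)
  (Omega : measurableType dO) (T : measurableType dT) (Xi : measurableType dX)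
  (P : probability Omega R) (D : probability Xi R)
  (X : Omega -> T) (eta : Omega -> Xi) (H : T * Xi -> \bar R) :
  measurable_fun setT X -> measurable_fun setT eta ->
  (forall A B, measurable A -> measurable B ->
     P (X @^-1` A `&` eta @^-1` B) = (P (X @^-1` A) * D B)%E) ->
  measurable_fun setT H -> (forall p, 0 <= H p)%E ->
  (\int[P]_w H (X w, eta w) = \int[P]_w \int[D]_z H (X w, z))%E.
Proof.
move=> mX meta indep mH H0.
have mpr : measurable_fun setT (fun w => (X w, eta w)) by exact/measurable_fun_pairP.
pose X' : {mfun Omega >-> T} := HB.pack X (isMeasurableFun.Build _ _ _ _ _ mX).
pose Y : {mfun Omega >-> (T * Xi)%type} :=
  HB.pack (fun w => (X w, eta w)) (isMeasurableFun.Build _ _ _ _ _ mpr).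
transitivity (\int[distribution P Y]_p H p)%E.
  by rewrite ge0_integral_distribution.
transitivity (\int[distribution P X' \x D]_p H p)%E.
  apply: eq_measure_integral => A mA _; apply/esym.
  apply: (@product_measure_unique _ _ _ _ _ (distribution P X') D (distribution P Y)) => //.
rewrite fubini_tonelli1 //.
rewrite ge0_integral_distribution //; first exact: measurable_fun_fubini_tonelli_F.
by move=> y; exact: integral_ge0.
Qed.

(** * Measurability of the run *)

Definition measurable_state {R : realType} {d : nat} {dT : measure_display}
    {T : measurableType dT} (r : T -> run_state R d) : Prop :=
  [/\ forall i, measurable_fun setT (fun t => xcur (r t) 0 i),
      forall i, measurable_fun setT (fun t => gacc (r t) 0 i) &
      forall k i, measurable_fun setT (fun t => hist (r t) k 0 i)].

Section MeasurableState.
Context (R : realType) (d : nat) (dX : measure_display) (Xi : measurableType dX).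
Context (G : 'rV[R]_d -> Xi -> 'rV[R]_d) (mG : G_jointly_measurable G).
Context (gamma : R) (n : nat) (tau : nat -> R) (S : nat).

Lemma measurable_state_comp (dT dT' : measure_display) (T : measurableType dT)
  (T' : measurableType dT') (r : T -> run_state R d) (h : T' -> T) :
  measurable_fun setT h -> measurable_state r -> measurable_state (r \o h).
Proof.
move=> mh [m1 m2 m3]; split=> *.
- exact: (measurableT_comp (m1 _) mh).
- exact: (measurableT_comp (m2 _) mh).
- exact: (measurableT_comp (m3 _ _) mh).
Qed.

Lemma measurable_state_cst (dT : measure_display) (T : measurableType dT)
  (r : run_state R d) : measurable_state (fun _ : T => r).
Proof. by split=> *; exact: measurable_cst. Qed.

(** The schedule is deterministic, so no test made in the step depends on [t]. *)
Lemma measurable_run_step (dT : measure_display) (T : measurableType dT)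
  (r : T -> run_state R d) (eta : T -> Xi) (s : sched_state) :
  measurable_state r -> measurable_fun setT eta ->
  measurable_state (fun t => run_step G (fun _ _ => eta t) gamma n tau S s (r t)).
Proof.
move=> [mx mg mh] meta; pose w := next_worker n tau (done_w s).
pose g' t := if tag_w s w == srv_k s
  then gacc (r t) + S%:R^-1 *: G (hist (r t) (tag_w s w)) (eta t) else gacc (r t).
have mg' i : measurable_fun setT (fun t => g' t 0 i).
  rewrite /g'; case: eqP => _; last exact: mg.
  under eq_fun do rewrite !mxE; apply: measurable_funD; first exact: mg.
  apply: measurable_funM; first exact: measurable_cst.
  by apply: mG => // j; exact: mh.
have mx' i : measurable_fun setT (fun t => (xcur (r t) - gamma *: g' t) 0 i).
  under eq_fun do rewrite !mxE; apply: measurable_funB; first exact: mx.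
  by apply: measurable_funM; [exact: measurable_cst|exact: mg'].
change (measurable_state (fun t =>
  if (srv_cnt s + (tag_w s w == srv_k s) == S)%N then
    RunState (xcur (r t) - gamma *: g' t) 0 (fun k =>
      if k == (srv_k s).+1 then xcur (r t) - gamma *: g' t else hist (r t) k)
  else RunState (xcur (r t)) (g' t) (hist (r t)))).
case: (_ == S); last by split.
split=> [i|i|k i] /=; [exact: mx'|exact: measurable_cst|].
by case: eqP => _; [exact: mx'|exact: mh].
Qed.

Lemma measurable_potential (dT : measure_display) (T : measurableType dT)
  (f : 'rV[R]_d -> R) (L fstar : R) (r : T -> run_state R d) (s : sched_state) :
  (forall x, differentiable f x) -> L_smooth L f -> measurable_state r ->
  measurable_fun setT (fun t => potential f L fstar gamma S s (r t)).
Proof.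
move=> df Lf [mx mg mh].
have mgrad (h : T -> 'rV[R]_d) : (forall i, measurable_fun setT (fun t => h t 0 i)) ->
    forall i, measurable_fun setT (fun t => gradient f (h t) 0 i).
  move=> m i; exact: (measurable_continuous_comp m (@continuous_gradient_coord _ _ _ _ i Lf)).
have me i : measurable_fun setT (fun t => grad_error f S s (r t) 0 i).
  rewrite /grad_error; under eq_fun do rewrite mxE [X in _ + X]mxE [X in _ - X]mxE.
  apply: measurable_funB; first exact: mg.
  by apply: measurable_funM; [exact: measurable_cst|exact: mgrad].
rewrite /potential /error_energy.
apply: measurable_funD; [apply: measurable_funD; [apply: measurable_funB|apply: measurable_funB]|].
- have cf : continuous f by move=> x; exact: differentiable_continuous.
  exact: (measurable_continuous_comp mx cf).
- exact: measurable_cst.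
- by apply: measurable_funM; [exact: measurable_cst|exact: measurable_sqnorm].
- by apply: measurable_funM; [exact: measurable_cst|apply: measurable_dotp => //; exact: mgrad].
- apply: measurable_funM; first exact: measurable_cst.
  apply: measurable_sum => k; apply: measurable_sqnorm; apply: mgrad; exact: mh.
Qed.

End MeasurableState.

(** * Samples consumed by the run *)

Definition sample_index {R : realType} (n : nat) (tau : nat -> R) (S m : nat) : nat * nat :=
  let c := done_w (sched n tau S m) in
  (next_worker n tau c, (c (next_worker n tau c)).+1).

Definition used_samples {R : realType} (n : nat) (tau : nat -> R) (S m : nat) : seq (nat * nat) :=
  [seq sample_index n tau S l | l <- rev (iota 0 m)].

Lemma used_samplesS (R : realType) (n : nat) (tau : nat -> R) (S m : nat) :
  used_samples n tau S m.+1 = sample_index n tau S m :: used_samples n tau S m.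
Proof. by rewrite /used_samples -addn1 iotaD rev_cat. Qed.

(** The sample of the next arrival has rank one above the delivered count, so this bound shows that
    it is fresh. *)
Lemma used_samples_le_done (R : realType) (n : nat) (tau : nat -> R) (S m : nat) e :
  e \in used_samples n tau S m -> (e.2 <= done_w (sched n tau S m) e.1)%N.
Proof.
elim: m => [//|m IH]; rewrite used_samplesS inE schedS /=.
by case/orP => [/eqP ->|/IH] /=; [rewrite eqxx|case: eqP => [->|]; lia].
Qed.

Lemma sample_index_fresh (R : realType) (n : nat) (tau : nat -> R) (S m : nat) :
  sample_index n tau S m \notin used_samples n tau S m.
Proof. by apply/negP => /used_samples_le_done /=; rewrite ltnn. Qed.

Lemma uniq_used_samples (R : realType) (n : nat) (tau : nat -> R) (S m : nat) :
  uniq (used_samples n tau S m).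
Proof. by elim: m => // m IH; rewrite used_samplesS /= sample_index_fresh. Qed.

(** Measurability is asked of the consumed samples alone, so [T] may carry just the sigma-algebra
    they generate. *)
Lemma measurable_run (R : realType) (d : nat) (dX dT : measure_display)
  (Xi : measurableType dX) (T : measurableType dT)
  (G : 'rV[R]_d -> Xi -> 'rV[R]_d) (mG : G_jointly_measurable G)
  (gamma : R) (n : nat) (tau : nat -> R) (S : nat) (x0 : 'rV[R]_d)
  (xi : nat -> nat -> T -> Xi) (m : nat) :
  (forall e, e \in used_samples n tau S m -> measurable_fun setT (xi e.1 e.2)) ->
  measurable_state (fun t => run G (fun i j => xi i j t) gamma n tau S x0 m).
Proof.
elim: m => [|m IH] mxi; first exact: measurable_state_cst.
have mIH := IH (fun e H => mxi e ltac:(by rewrite used_samplesS inE H orbT)).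
have mfresh := mxi (sample_index n tau S m) ltac:(by rewrite used_samplesS inE eqxx).
exact: (measurable_run_step mG gamma n tau S (sched n tau S m) mIH mfresh).
Qed.

(** * Independence of the past and a fresh sample *)

Section Independence.
Context (R : realType) (dX dO : measure_display) (Xi : measurableType dX)
  (Omega : measurableType dO) (P : probability Omega R) (D : probability Xi R)
  (xi : nat -> nat -> Omega -> Xi).
Hypotheses (mxi : forall i j, measurable_fun setT (xi i j))
  (lawxi : forall i j A, measurable A -> P (xi i j @^-1` A) = D A)
  (indxi : mutually_independent P xi).

(** An intersection-stable class generating the sigma-algebra of the samples indexed by [s]. *)
Definition cylinders (s : seq (nat * nat)) : set (set Omega) :=
  [set B | exists2 A : nat * nat -> set Xi, forall e, measurable (A e) &
     B = [set w | forall e, e \in s -> A e (xi e.1 e.2 w)]].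

Lemma measurable_xi_preimage i j A : measurable A -> measurable (xi i j @^-1` A).
Proof. by move=> mA; rewrite -[X in measurable X]setTI; exact: mxi. Qed.

Lemma measurable_cylinders s : cylinders s `<=` measurable.
Proof.
move=> _ [A mA ->]; elim: s => [|e s IH].
  by rewrite (_ : [set _ | _] = setT) //; apply/seteqP; split.
rewrite (_ : [set _ | _] = (xi e.1 e.2 @^-1` A e) `&`
    [set w | forall e', e' \in s -> A e' (xi e'.1 e'.2 w)]).
  by apply: measurableI => //; exact: measurable_xi_preimage.
apply/seteqP; split=> w /=.
  by move=> H; split=> [|e' e's]; apply: H; rewrite inE ?eqxx // e's orbT.
by move=> [H1 H2] e'; rewrite inE => /orP[/eqP ->|]; [exact: H1|exact: H2].
Qed.

Lemma cylinders_setI_closed s : setI_closed (cylinders s).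
Proof.
move=> _ _ [A mA ->] [B mB ->]; exists (fun e => A e `&` B e).
  by move=> e; exact: measurableI.
apply/seteqP; split=> w /=; first by move=> [H1 H2] e es; split; [exact: H1|exact: H2].
by move=> H; split=> e es; have [] := H e es.
Qed.

Lemma cylinders_setT s : cylinders s setT.
Proof. by exists (fun=> setT) => //; apply/seteqP; split. Qed.

Lemma cylinders_xi s e B : e \in s -> measurable B ->
  cylinders s (xi e.1 e.2 @^-1` B).
Proof.
move=> es mB; exists (fun e' => if e' == e then B else setT).
  by move=> e'; case: eqP.
apply/seteqP; split=> w /=; first by move=> H e' _; case: eqP => [->|].
by move=> /(_ e es); rewrite eqxx.
Qed.

(** Constraining the sample [e] by [B] turns a cylinder on [s] into one on [e :: s]; mutual
    independence on both lists leaves the extra factor [D B]. *)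
Lemma cylinders_indep s e A B : uniq s -> e \notin s -> cylinders s A ->
  measurable B -> P (A `&` xi e.1 e.2 @^-1` B) = (P A * D B)%E.
Proof.
move=> us es [C mC ->] mB.
pose C' e' := if e' == e then B else C e'.
have mC' e' : measurable (C' e') by rewrite /C'; case: eqP.
rewrite (indxi us mC) -(lawxi e.1 e.2 mB) muleC.
have ues : uniq (e :: s) by rewrite /= es.
transitivity (P [set w | forall e', e' \in e :: s -> C' e' (xi e'.1 e'.2 w)]).
  congr (P _); apply/seteqP; split=> w /=.
    move=> [H1 H2] e'; rewrite inE /C'; case: eqP => [-> //|_ /= e's].
    exact: H1.
  move=> H; split=> [e' e's|].
    have := H e'; rewrite inE e's orbT /C'; case: eqP => [ee|_]; last exact.
    by move: es; rewrite -ee e's.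
  by have := H e; rewrite inE eqxx /C' eqxx; exact.
rewrite (indxi ues mC') big_cons /C' eqxx; congr (_ * _)%E.
apply: eq_big_seq => e' e's; case: eqP => // ee.
by move: es; rewrite -ee e's.
Qed.

(** Here [X] is the identity from [Omega] to the same set with the sigma-algebra of the past. *)
Lemma ge0_integral_fresh s e (H : g_sigma_algebraType (cylinders s) * Xi -> \bar R) :
  uniq s -> e \notin s -> measurable_fun setT H -> (forall p, 0 <= H p)%E ->
  (\int[P]_w H (w, xi e.1 e.2 w) = \int[P]_w \int[D]_z H (w, z))%E.
Proof.
move=> us es mH H0.
apply: (@ge0_integral_indep R dO _ dX Omega (g_sigma_algebraType (cylinders s)) Xi P D
  id (xi e.1 e.2) H) => //.
- move=> _ A mA; rewrite setTI; apply: (smallest_sub _ _ mA) => //.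
  + exact: sigma_algebra_measurable.
  + exact: measurable_cylinders.
- move=> A B mA mB.
  apply: (@g_sigma_algebra_indep R dO dX Omega Xi P D (cylinders s) (xi e.1 e.2) B) => //.
  + exact: measurable_cylinders.
  + exact: cylinders_setI_closed.
  + exact: cylinders_setT.
  + by move=> A' CA'; apply: (cylinders_indep us es CA' mB).
Qed.

End Independence.

(** * Expected potential *)

Local Opaque past_gradients.

Lemma integral_cst_probability (R : realType) (dT : measure_display)
  (T : measurableType dT) (P : probability T R) (c : \bar R) :
  (\int[P]_x c = c)%E.
Proof.
rewrite integral_cst // -[RHS]mule1; congr (_ * _)%E.
exact: probability_setT.
Qed.

Section ConditionalStep.
Context (R : realType) (d : nat) (dX : measure_display) (Xi : measurableType dX)
  (D : probability Xi R) (f : 'rV[R]_d -> R) (G : 'rV[R]_d -> Xi -> 'rV[R]_d)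
  (sigma2 : R).
Hypotheses (mG : G_jointly_measurable G)
  (unbiased : forall x (i : 'I_d), D.-integrable setT (fun z => (G x z 0 i)%:E) /\
      (\int[D]_z (G x z 0 i)%:E = (gradient f x 0 i)%:E)%E)
  (variance : forall x, (\int[D]_z (sqnorm (G x z - gradient f x))%:E <= sigma2%:E)%E).

Lemma noiseE x z i : noise f G x z 0 i = G x z 0 i - gradient f x 0 i.
Proof. by rewrite mxE [X in _ + X]mxE. Qed.

Lemma measurable_noise x i : measurable_fun setT (fun z => noise f G x z 0 i).
Proof.
under eq_fun do rewrite noiseE.
apply: measurable_funB; last exact: measurable_cst.
by apply: mG => [j|]; [exact: measurable_cst|exact: measurable_id].
Qed.

Lemma integrable_noise x i : D.-integrable setT (fun z => (noise f G x z 0 i)%:E).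
Proof.
under eq_fun do rewrite noiseE EFinB.
apply: integrableB => //; first by have [] := unbiased x i.
exact: finite_measure_integrable_cst.
Qed.

Lemma integral_noise x i : (\int[D]_z (noise f G x z 0 i)%:E = 0)%E.
Proof.
under eq_integral do rewrite noiseE EFinB.
have [intG EG] := unbiased x i.
rewrite integralB //; last exact: finite_measure_integrable_cst.
by rewrite EG integral_cst_probability subee.
Qed.

Lemma integral_dotp_noise b x :
  D.-integrable setT (fun z => (dotp b (noise f G x z))%:E) /\
  (\int[D]_z (dotp b (noise f G x z))%:E = 0)%E.
Proof.
have e : (fun z => (dotp b (noise f G x z))%:E) =
    (fun z => \sum_(i < d) (b 0 i)%:E * (noise f G x z 0 i)%:E)%E.
  by apply/funext => z; rewrite sumEFin.
have ii i : D.-integrable setT (fun z => (b 0 i)%:E * (noise f G x z 0 i)%:E)%E.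
  by apply: integrableZl => //; exact: integrable_noise.
rewrite e; split; first exact: integrable_sum.
rewrite integral_sum // big1 // => i _.
by rewrite integralZl //; [rewrite integral_noise mule0|exact: integrable_noise].
Qed.

(** Unbiasedness removes the linear term and [sigma2] bounds the quadratic one. *)
Lemma integral_noise_bound (h : Xi -> R) (p c : R) b x : 0 <= c ->
  measurable_fun setT h -> (forall z, 0 <= h z) ->
  (forall z, h z <= p + (dotp b (noise f G x z) + c * sqnorm (noise f G x z))) ->
  (\int[D]_z (h z)%:E <= (p + c * sigma2)%:E)%E.
Proof.
move=> c0 mh h0 hle.
have [id_ Ed] := integral_dotp_noise b x.
have msq : measurable_fun setT (fun z => (sqnorm (noise f G x z))%:E).
  by apply/measurable_EFinP; apply: measurable_sqnorm => i; exact: measurable_noise.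
have isq : D.-integrable setT (fun z => (sqnorm (noise f G x z))%:E).
  apply/integrableP; split=> //.
  rewrite (_ : (fun z => _) = (fun z => (sqnorm (noise f G x z))%:E)); last first.
    by apply/funext => z; rewrite gee0_abs // lee_fin sqnorm_ge0.
  exact: le_lt_trans (variance x) (ltry _).
have icst : D.-integrable setT (fun _ : Xi => p%:E) by exact: finite_measure_integrable_cst.
have icsq : D.-integrable setT (fun z => c%:E * (sqnorm (noise f G x z))%:E)%E.
  exact: integrableZl.
have isum : D.-integrable setT (fun z => (dotp b (noise f G x z))%:E +
     c%:E * (sqnorm (noise f G x z))%:E)%E by exact: integrableD.
apply: (@le_trans _ _ (\int[D]_z (p%:E + ((dotp b (noise f G x z))%:E +
     c%:E * (sqnorm (noise f G x z))%:E)))%E).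
  apply: ge0_le_integral => //.
  - by move=> z _; rewrite lee_fin.
  - by apply/measurable_EFinP.
  - by have /integrableP[] := integrableD measurableT icst isum.
  - by move=> z _; rewrite -EFinM -!EFinD lee_fin.
rewrite integralD // integralD // Ed add0e integralZl //.
rewrite integral_cst_probability EFinD EFinM leeD2l //.
by apply: lee_wpmul2l; rewrite ?lee_fin // variance.
Qed.

Context (L fstar gamma : R) (n : nat) (tau : nat -> R) (S : nat).
Hypotheses (L_gt0 : 0 < L) (gamma_ge0 : 0 <= gamma) (Lgamma_le1 : L * gamma <= 1).
Hypotheses (S_gt0 : (0 < S)%N) (fstarP : forall x, fstar <= f x).
Hypotheses (df : forall x, differentiable f x) (Lf : L_smooth L f).

Let acc s := (tag_w s (next_worker n tau (done_w s)) == srv_k s : nat).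
Let pot := potential f L fstar gamma S.
Let cost := L * gamma ^+ 2 / (2 * S%:R ^+ 2) * sigma2.

Lemma integral_potential_step s (r : run_state R d) :
  (srv_cnt s < S)%N -> hist r (srv_k s) = xcur r ->
  (\int[D]_z (pot (sched_step n tau S s)
      (run_step G (fun _ _ => z) gamma n tau S s r))%:E
   <= (pot s r)%:E + ((acc s)%:R * cost)%:E)%E.
Proof.
move=> cS hx.
have c0 : 0 <= L * gamma ^+ 2 / (2 * S%:R ^+ 2).
  by rewrite divr_ge0 ?mulr_ge0 ?sqr_ge0 // ltW.
have step z := potential_step G fstar n tau L_gt0 gamma_ge0 Lgamma_le1 S_gt0 df Lf z cS hx.
have pos s' r' : 0 <= pot s' r' by exact: potential_ge0.
have mh : measurable_fun setT (fun z => pot (sched_step n tau S s)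
      (run_step G (fun _ _ => z) gamma n tau S s r)).
  apply: (measurable_potential gamma S fstar _ df Lf).
  apply: (measurable_run_step mG); first exact: measurable_state_cst.
  exact: measurable_id.
rewrite -EFinD /acc; move: step; case: eqP => _ step.
  rewrite mul1r; apply: (integral_noise_bound (b := slope f L gamma S s r) (x := xcur r)) => //.
(* A rejected gradient contributes no noise: the same bound applies with zero [b] and zero [c]. *)
rewrite mul0r -(mul0r sigma2).
apply: (integral_noise_bound (b := 0) (x := xcur r)) => // z.
by rewrite dotp0l mul0r addr0; exact: step.
Qed.

Context (dO : measure_display) (Omega : measurableType dO) (P : probability Omega R)
  (xi : nat -> nat -> Omega -> Xi) (x0 : 'rV[R]_d).
Hypotheses (mxi : forall i j, measurable_fun setT (xi i j))
  (lawxi : forall i j A, measurable A -> P (xi i j @^-1` A) = D A)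
  (indxi : mutually_independent P xi).

Let st := sched n tau S.
Let rn m w := run G (fun i j => xi i j w) gamma n tau S x0 m.

Lemma hist_run m w : hist (rn m w) (srv_k (st m)) = xcur (rn m w).
Proof.
elim: m => [//|m IH]; rewrite /rn /st schedS /= /run_step /= -/(rn m w) -/(st m).
by case: ifP => _ /=; rewrite ?eqxx.
Qed.

Lemma integral_potential_run_step m :
  (\int[P]_w (pot (st m.+1) (rn m.+1 w))%:E <=
   \int[P]_w (pot (st m) (rn m w))%:E + ((acc (st m))%:R * cost)%:E)%E.
Proof.
set e := sample_index n tau S m; set us := used_samples n tau S m.
have pos s' r' : 0 <= pot s' r' by exact: potential_ge0.
have sigma0 : 0 <= sigma2.
  rewrite -lee_fin; apply: le_trans (variance 0).
  by apply: integral_ge0 => z _; rewrite lee_fin sqnorm_ge0.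
have cost0 : 0 <= (acc (st m))%:R * cost.
  by rewrite !mulr_ge0 ?divr_ge0 ?mulr_ge0 ?sqr_ge0 // ltW.
(* [F] is [Omega] with the sigma-algebra of the past; [H] separates the past from the new sample. *)
pose F := g_sigma_algebraType (cylinders xi us).
pose H (p : F * Xi) := (pot (st m.+1)
  (run_step G (fun _ _ => p.2) gamma n tau S (st m) (rn m p.1)))%:E.
have mF : measurable_state (fun w : F => rn m w).
  apply: measurable_run mG _ _ _ _ _ _ _ _ => e' e'us _ B mB.
  rewrite setTI; apply: sub_sigma_algebra; exact: cylinders_xi.
have mH : measurable_fun setT H.
  apply/measurable_EFinP; apply: (measurable_potential gamma S fstar _ df Lf).
  apply: (measurable_run_step mG); last exact: measurable_snd.
  exact: (measurable_state_comp measurable_fst mF).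
have := ge0_integral_fresh mxi lawxi indxi (uniq_used_samples n tau S m)
  (sample_index_fresh n tau S m) mH.
rewrite -/e => E.
rewrite (_ : (\int[P]_w _)%E = (\int[P]_w H (w, xi e.1 e.2 w))%E); last by [].
rewrite E; last by move=> p; rewrite lee_fin.
have mP : measurable_fun setT (fun w : Omega => (pot (st m) (rn m w))%:E).
  apply/measurable_EFinP; apply: (measurable_potential gamma S fstar _ df Lf).
  by apply: (measurable_run mG).
apply: (@le_trans _ _ (\int[P]_w ((pot (st m) (rn m w))%:E + ((acc (st m))%:R * cost)%:E))%E).
  apply: ge0_le_integral => //.
  - by move=> w _; apply: integral_ge0 => z _; rewrite lee_fin.
  (* The inner integral is measurable for the past, hence for the larger sigma-algebra of
     [Omega]. *)
  - have mK : measurable_fun setT (fun w : F => \int[D]_z H (w, z))%E.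
      by apply: measurable_fun_fubini_tonelli_F => // p; rewrite lee_fin.
    move=> _ B mB; rewrite setTI.
    have sub : <<s cylinders xi us >> `<=` @measurable _ Omega.
      by apply: smallest_sub; [exact: sigma_algebra_measurable|exact: measurable_cylinders].
    apply: sub.
    by have := mK measurableT B mB; rewrite setTI.
  - by apply: emeasurable_funD => //; exact: measurable_cst.
  - move=> w _; have cS : (srv_cnt (st m) < S)%N by exact: srv_cnt_lt.
    exact: (integral_potential_step cS (hist_run m w)).
rewrite ge0_integralD //.
  by rewrite integral_cst_probability.
by move=> w _; rewrite lee_fin.
Qed.

(** [S * srv_k + srv_cnt] counts the gradients accepted so far, each raising the bound by [cost];
    the initial potential is [f x0 - fstar]. *)
Lemma integral_potential_run m :
  (\int[P]_w (pot (st m) (rn m w))%:E <=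
   (f x0 - fstar + (S * srv_k (st m) + srv_cnt (st m))%:R * cost)%:E)%E.
Proof.
elim: m => [|m IH].
  rewrite /rn /st /= integral_cst_probability lee_fin /pot /potential /= /grad_error /=.
  rewrite mul0r scale0r subr0 /error_energy sqnorm0 dotp0r past_gradients0.
  by rewrite muln0 mul0r !mulr0 subr0 !addr0.
apply: (le_trans (integral_potential_run_step m)).
apply: (le_trans (leeD2r _ IH)).
rewrite -EFinD lee_fin -addrA -mulrDl -natrD.
rewrite (_ : (S * srv_k (st m.+1) + srv_cnt (st m.+1))%N =
   (S * srv_k (st m) + srv_cnt (st m) + acc (st m))%N) //.
rewrite /st schedS /= -/(st m) -addnA /acc.
by case: eqP => [->|]; rewrite ?addn0 // mulnS addnC.
Qed.

Lemma sum_integral_gradients m :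
  ((gamma / 2)%:E * \sum_(k < srv_k (st m))
     \int[P]_w (sqnorm (gradient f (hist (rn m w) k)))%:E <=
   (f x0 - fstar + (S * srv_k (st m) + srv_cnt (st m))%:R * cost)%:E)%E.
Proof.
apply: le_trans (integral_potential_run m).
have [mx mg mh] : measurable_state (rn m) by apply: (measurable_run mG).
have mterm k : measurable_fun setT (fun w => (sqnorm (gradient f (hist (rn m w) k)))%:E).
  apply/measurable_EFinP; apply: measurable_sqnorm => i.
  exact: (measurable_continuous_comp (mh k) (@continuous_gradient_coord _ _ _ _ i Lf)).
have pterm k w : (0 <= (sqnorm (gradient f (hist (rn m w) k)))%:E)%E.
  by rewrite lee_fin sqnorm_ge0.
have mpot : measurable_fun setT (fun w : Omega => (pot (st m) (rn m w))%:E).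
  by apply/measurable_EFinP; exact: (measurable_potential gamma S fstar _ df Lf).
rewrite -ge0_integral_sum // -ge0_integralZl //.
- apply: ge0_le_integral => //.
  + move=> w _; rewrite mule_ge0 ?lee_fin ?divr_ge0 //; exact: sume_ge0.
  + by apply: measurable_funeM; exact: emeasurable_sum.
  + move=> w _; rewrite sumEFin -EFinM lee_fin.
    exact: past_gradients_le_potential.
- exact: emeasurable_sum.
- by move=> w _; exact: sume_ge0.
- by rewrite lee_fin divr_ge0.
Qed.

End ConditionalStep.

(** * Parameters and the time bound *)

Lemma batchS_gt0 (R : realType) (sigma2 eps : R) : (0 < batchS sigma2 eps)%N.
Proof. by rewrite /batchS leq_max ltnSn orbT. Qed.

Lemma batchS_ge (R : realType) (sigma2 eps : R) : sigma2 / eps <= (batchS sigma2 eps)%:R.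
Proof.
apply: (@le_trans _ _ (`|Num.ceil (sigma2 / eps)|%N)%:R); last by rewrite ler_nat leq_maxl.
apply: le_trans (ceil_ge _) _.
by rewrite pmulrn ler_int lez_abs.
Qed.

Lemma batchS_le (R : realType) (sigma2 eps : R) : 0 <= sigma2 / eps ->
  (batchS sigma2 eps)%:R <= sigma2 / eps + 1.
Proof.
move=> x0; have c0 : 0 <= Num.ceil (sigma2 / eps).
  by rewrite -(ler_int R); exact: le_trans x0 (ceil_ge _).
rewrite /batchS natr_max ge_max; apply/andP; split; last by rewrite lerDr.
rewrite pmulrn gez0_abs //; apply: ltW.
by rewrite -ltrBlDr -[X in _ - X]/(1%:~R) -intrB ceilB1_lt.
Qed.

(** The third bound holds for both candidates of the minimum: [2 * L * gamma] is 2 for [L^-1], and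
    [eps * S / sigma2] for the other, at least 1 by the choice of [S]. The last bound comes from the
    second candidate. *)
Lemma stepsizeP (R : realType) (L sigma2 eps : R) :
  0 < L -> 0 <= sigma2 -> 0 < eps ->
  let gamma := stepsize L sigma2 eps in let S := (batchS sigma2 eps)%:R in
  [/\ 0 < gamma, L * gamma <= 1, 1 <= 2 * L * gamma &
    L * gamma * sigma2 / S <= eps / 2].
Proof.
move=> L0 s0 e0 gamma S.
have S0 : 0 < S by rewrite ltr0n batchS_gt0.
have LV : L * L^-1 = 1 by rewrite mulfV ?gt_eqF.
rewrite /gamma /stepsize; case: eqP => [->|/eqP sn0].
  by rewrite invr_gt0 -mulrA LV mulr0 mul0r; split; lra.
have sp : 0 < sigma2 by rewrite lt_neqAle eq_sym sn0.
rewrite -/S; set b := eps * S / _.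
have bL : L * b = eps * S / (2 * sigma2) by rewrite /b; field; rewrite !gt_eqF.
have bhalf : 1 <= 2 * (L * b).
  rewrite bL (_ : 2 * _ = eps * S / sigma2); last by field; rewrite gt_eqF.
  rewrite ler_pdivlMr // mul1r mulrC -ler_pdivrMr //; exact: batchS_ge.
have b0 : 0 < b by rewrite divr_gt0 ?mulr_gt0.
have minP t : L * Num.min L^-1 b <= L * t <-> Num.min L^-1 b <= t by rewrite ler_pM2l.
split.
- by rewrite lt_min invr_gt0 L0.
- by rewrite -LV minP ge_min lexx.
- by rewrite -mulrA /Order.min; case: ifP => _ //; rewrite LV mulr1 ler1n.
- have : L * Num.min L^-1 b <= L * b by rewrite minP ge_min lexx orbT.
  rewrite bL ler_pdivlMr ?mulr_gt0 // ler_pdivrMr // => bd; lra.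
Qed.

(** The default of the minimum is the term of index 1, in range because [n] is positive, so the
    minimum is attained. *)
Lemma rennala_boundE (R : realType) (n : nat) (tau : nat -> R)
  (L Delta eps sigma2 : R) : (0 < n)%N ->
  exists2 q, (0 < q <= n)%N &
    rennala_bound n tau L Delta eps sigma2 = 96 * rennala_term tau L Delta eps sigma2 q.
Proof.
move=> n0; rewrite /rennala_bound big_nat_cond.
suff [q qn ->] : exists2 q, (0 < q <= n)%N &
  \big[Order.min/rennala_term tau L Delta eps sigma2 1]_(1 <= m < n.+1 | (1 <= m < n.+1)%N && true)
    rennala_term tau L Delta eps sigma2 m = rennala_term tau L Delta eps sigma2 q.
  by exists q.
apply: (big_ind (fun x => exists2 q, (0 < q <= n)%N &
  x = rennala_term tau L Delta eps sigma2 q)).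
- by exists 1%N.
- move=> _ _ [q qn ->] [q' qn' ->].
  by rewrite /Order.min; case: ifP => _; [exists q|exists q'].
- by move=> q /andP[/andP[q0 qn] _]; exists q => //; rewrite q0.
Qed.

(** With [H] the sum of the rates, the term equals [L * Delta / (eps * H) * (q + sigma2 / eps)].
    Since [S + 2 q <= sigma2 / eps + 1 + 2 q <= 4 (q + sigma2 / eps)], the constant is
    [24 * 4 = 96]. *)
Lemma iteration_time_le_term (R : realType) (n : nat) (tau : nat -> R)
  (L Delta eps sigma2 K : R) (q : nat) :
  0 < L -> 0 <= sigma2 -> 0 < eps -> 0 <= Delta -> (0 < q)%N ->
  (forall i, (i < q)%N -> 0 < tau i) -> K = 24 * L * Delta / eps ->
  K * (((batchS sigma2 eps)%:R + 2 * q%:R) / \sum_(i < q) (tau i)^-1) <=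
  96 * rennala_term tau L Delta eps sigma2 q.
Proof.
move=> L0 s0 e0 D0 q0 tau0 ->; rewrite /rennala_term.
set H := \sum_(i < q) _.
have H0 : 0 < H.
  rewrite /H (bigD1 (Ordinal q0)) //= ltr_wpDr ?invr_gt0 ?tau0 //.
  by apply: sumr_ge0 => i _; rewrite invr_ge0 ltW // tau0.
have q1 : 1 <= q%:R :> R by rewrite ler1n.
have x0 : 0 <= sigma2 / eps by rewrite divr_ge0 // ltW.
have Sx := batchS_le x0.
set A := L * Delta / eps; have A0 : 0 <= A by rewrite divr_ge0 ?mulr_ge0 // ltW.
have [qN HN eN] : [/\ q%:R != 0 :> R, H != 0 & eps != 0].
  by rewrite !gt_eqF // ltr0n.
have -> : 96 * ((q%:R^-1 * H)^-1 * (A + sigma2 * L * Delta / (q%:R * eps ^+ 2))) =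
   96 * (A / H) * (q%:R + sigma2 / eps).
  by rewrite /A; field; rewrite qN HN eN.
have -> : 24 * L * Delta / eps * (((batchS sigma2 eps)%:R + 2 * q%:R) / H) =
   24 * (A / H) * ((batchS sigma2 eps)%:R + 2 * q%:R).
  by rewrite /A; field; rewrite HN eN.
have AH : 0 <= A / H by rewrite divr_ge0 // ltW.
have : 0 <= A / H * (4 * (q%:R + sigma2 / eps) - ((batchS sigma2 eps)%:R + 2 * q%:R)).
  by rewrite mulr_ge0 //; lra.
by move: (A / H) => B; lra.
Qed.

Theorem mainTheorem3 (R : realType) (d : nat)
  (dX : measure_display) (Xi : measurableType dX) (D : probability Xi R)
  (dO : measure_display) (Omega : measurableType dO) (P : probability Omega R)
  (f : 'rV[R]_d -> R) (G : 'rV[R]_d -> Xi -> 'rV[R]_d)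
  (L sigma2 eps fstar : R) (x0 : 'rV[R]_d)
  (n : nat) (tau : nat -> R) (xi : nat -> nat -> Omega -> Xi) (K : nat) :
  (* f differentiable, L-smooth, bounded below by f^* *)
  (forall x, differentiable f x) ->
  0 < L -> L_smooth L f ->
  (forall x, fstar <= f x) ->
  (* stochastic gradients: unbiased with variance at most sigma^2 *)
  G_jointly_measurable G ->
  (forall x (i : 'I_d), D.-integrable setT (fun z => (G x z 0 i)%:E) /\
      (\int[D]_z (G x z 0 i)%:E = (gradient f x 0 i)%:E)%E) ->
  (forall x, (\int[D]_z (sqnorm (G x z - gradient f x))%:E <= sigma2%:E)%E) ->
  0 <= sigma2 -> 0 < eps ->
  (* n workers with times 0 < tau_1 <= ... <= tau_n *)
  (0 < n)%N ->
  (forall i, (i < n)%N -> 0 < tau i) ->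
  (forall i j, (i <= j < n)%N -> tau i <= tau j) ->
  (* fresh i.i.d. samples xi ~ D for every computation *)
  (forall i j, measurable_fun setT (xi i j)) ->
  (forall i j A, measurable A -> P (xi i j @^-1` A) = D A) ->
  mutually_independent P xi ->
  (* K = 24 L Delta / eps is an integer *)
  K%:R = 24 * L * (f x0 - fstar) / eps ->
  let S := batchS sigma2 eps in
  let gamma := stepsize L sigma2 eps in
  exists m : nat,
    (* after m arrivals the server is in iteration K, i.e. x^0..x^K computed *)
    srv_k (sched n tau S m) = K /\
    (* ... and all these arrivals happened by the claimed time *)
    (forall m', (m' < m)%N ->
       event_time n tau S m' <= rennala_bound n tau L (f x0 - fstar) eps sigma2) /\
    (* (1/K) sum_{k<K} E ||grad f(x^k)||^2 <= eps *)
    ((K%:R^-1)%:E *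
       \sum_(k < K) \int[P]_w
          (sqnorm (gradient f (hist (run G (fun i j => xi i j w) gamma n tau S x0 m) k)))%:E
     <= eps%:E)%E.
Proof.
move=> df L0 Lf fstarP mG unb var s0 e0 n0 tau0 taumono mxi lawxi indxi KE S gamma.
have [q /andP[q0 qn] boundE] := rennala_boundE tau L (f x0 - fstar) eps sigma2 n0.
have S0 : (0 < S)%N := batchS_gt0 sigma2 eps.
have D0 : 0 <= f x0 - fstar by rewrite subr_ge0.
have [] := stepsizeP L0 s0 e0; rewrite -/S -/gamma => g0 Lg1 Lg2 gs.
have [m [mK mc mt]] := iteration_time S0 n0 tau0 K (introT andP (conj q0 qn)).
exists m; split=> //; split.
  move=> m' m'm; rewrite boundE; apply: le_trans (mt m' m'm) _.
  apply: iteration_time_le_term => // i iq; apply: tau0; exact: leq_trans iq qn.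
have := sum_integral_gradients mG unb var n tau L0 (ltW g0) Lg1 S0 fstarP df Lf x0 mxi lawxi indxi m.
rewrite mK mc addn0.
set E := (\sum_(_ < _) _)%E => HE.
have E0 : (0 <= E)%E.
  by apply: sume_ge0 => k _; apply: integral_ge0 => w _; rewrite lee_fin sqnorm_ge0.
(* After multiplication by [gamma / 2] the target is [K eps gamma / 2]. The initial gap
   [K eps / (24 L)] is at most [K eps gamma / 12] and the noise costs at most [K eps gamma / 4],
   together a third of [K eps gamma]. *)
have HE' : (E <= (K%:R * eps)%:E)%E.
  rewrite -(@lee_pmul2l _ (gamma / 2)%:E) ?lte_fin ?divr_gt0 //.
  apply: (le_trans HE); rewrite -EFinM lee_fin.
  have DE : f x0 - fstar = K%:R * eps / (24 * L).
    by rewrite KE; field; rewrite !gt_eqF.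
  have LV : 1 / (24 * L) <= gamma / 12.
    rewrite ler_pdivrMr ?mulr_gt0 //; lra.
  have Keps : 0 <= K%:R * eps by rewrite mulr_ge0 // ltW.
  have D1 : f x0 - fstar <= K%:R * eps * (gamma / 12).
    by rewrite DE -[(24 * L)^-1]mul1r; exact: ler_wpM2l.
  have SR : 0 < (S%:R : R) by rewrite ltr0n.
  have costE : (S * K)%:R * (L * gamma ^+ 2 / (2 * S%:R ^+ 2) * sigma2) =
      K%:R * gamma / 2 * (L * gamma * sigma2 / S%:R).
    by rewrite natrM; field; rewrite gt_eqF.
  have cost_le : K%:R * gamma / 2 * (L * gamma * sigma2 / S%:R) <=
      K%:R * gamma / 2 * (eps / 2).
    by rewrite ler_wpM2l // divr_ge0 ?mulr_ge0 // ltW.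
  rewrite costE; have : 0 <= K%:R * eps * gamma by rewrite mulr_ge0 // ltW.
  lra.
apply: (@le_trans _ _ ((K%:R^-1)%:E * (K%:R * eps)%:E)%E).
  by apply: lee_wpmul2l => //; rewrite lee_fin invr_ge0.
rewrite -EFinM lee_fin mulrA.
(* For [K = 0] the left side is 0. *)
have [->|Kn0] := eqVneq (K%:R : R) 0; first by rewrite mulr0 mul0r ltW.
by rewrite mulVf // mul1r.
Qed.
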